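(* $$\int_0^{\infty} e^{-\mathrm{arccosh}^2(x)}\,dx = \frac{\sqrt{\pi}}{4}\,e^{1/4}\left[\mathrm{erf}\!\left(\frac{1}{2}-\frac{i\pi}{2}\right)+\mathrm{erf}\!\left(\frac{1}{2}+\frac{i\pi}{2}\right)\right].$$
   Context: $\mathrm{arccosh}(x)=\ln\!\left(x+\sqrt{x^2-1}\right)$, with principal branches of the complex logarithm and square root; thus for $0\le x<1$ one has $\sqrt{x^2-1}=i\sqrt{1-x^2}$ and $\mathrm{arccosh}(x)$ is purely imaginary, with $\mathrm{arccosh}(0)=\frac{i\pi}{2}$. For complex $z$, $\mathrm{erf}(z)=\frac{2}{\sqrt{\pi}}\int_0^z e^{-t^2}\,dt$ (integral along the straight segment from $0$ to $z$). Here $i$ is the imaginary unit. *)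

(* Defs.v *)
From Stdlib Require Import Reals.
From Coquelicot Require Import Coquelicot.

Local Open Scope R_scope.

Definition Cexp (z : C) : C :=
  (exp (Re z) * cos (Im z), exp (Re z) * sin (Im z)).

(** Principal argument, with values in (-PI, PI]: points of the negative real
    axis get PI.  The value at 0 is irrelevant. *)
Definition Carg (z : C) : R :=
  if Rlt_dec (Im z) 0 then - acos (Re z / Cmod z) else acos (Re z / Cmod z).

Definition Cln (z : C) : C := (ln (Cmod z), Carg z).

Definition Csqrt (z : C) : C :=
  (RtoC (sqrt (Cmod z)) * Cexp (Ci * RtoC (Carg z / 2)))%C.

Definition Carccosh (z : C) : C :=
  Cln (z + Csqrt (z ^ 2 - RtoC 1))%C.

(** The segment from 0 to [z] is parametrized by [t * z], 0 <= t <= 1. *)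
Definition Cerf (z : C) : C :=
  (RtoC (2 / sqrt PI) *
   RInt (V := C_R_CompleteNormedModule)
     (fun t : R => Cexp (- (RtoC t * z) ^ 2) * z) 0 1)%C.

(* Main.v *)
(* Substituting [x = cos s] on [0, 1] and [x = cosh u] on [1, infinity) turns
   the integral into that of [exp (s^2) sin s] over [0, PI/2] plus that of
   [exp (- u^2) sinh u] over [0, infinity).  Completing the square, the latter
   equals [exp (1/4)] times the integral of [exp (- v^2)] over [0, 1/2], so the
   Gaussian integral itself is never needed.  On the other side, the sum of the
   two erf values is twice the real part of erf at [1/2 + i b], [b = PI/2]; its
   derivative in [b] is, up to the constant, [exp (b^2 - 1/4) sin b], and
   integrating from the real point [b = 0] yields the same two terms. *)
Require Import Defs.
From Stdlib Require Import Reals Lra.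
From Coquelicot Require Import Coquelicot.

Local Open Scope R_scope.

(** * Principal branches on the real line and the integrand in real form *)

Lemma Carg_RtoC_neg (x : R) : x < 0 -> Carg (RtoC x) = PI.
Proof.
intros hx; unfold Carg; simpl.
destruct (Rlt_dec 0 0) as [h | _]; [lra |].
rewrite Cmod_R, Rabs_left by assumption.
replace (x / - x) with (Ropp 1) by (field; lra).
rewrite acos_opp, acos_1; ring.
Qed.

Lemma Carg_RtoC_pos (x : R) : 0 < x -> Carg (RtoC x) = 0.
Proof.
intros hx; unfold Carg; simpl.
destruct (Rlt_dec 0 0) as [h | _]; [lra |].
rewrite Cmod_R, Rabs_pos_eq by lra.
replace (x / x) with 1 by (field; lra).
exact acos_1.
Qed.

Lemma Csqrt_RtoC_nonneg (x : R) : 0 <= x -> Csqrt (RtoC x) = RtoC (sqrt x).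
Proof.
intros hx; unfold Csqrt.
destruct (Rle_lt_or_eq_dec 0 x hx) as [h | <-].
- rewrite Carg_RtoC_pos, Cmod_R, Rabs_pos_eq by assumption.
  unfold Cexp; simpl.
  replace (0 * (0 / 2) - 1 * 0) with 0 by ring.
  replace (0 * 0 + 1 * (0 / 2)) with 0 by field.
  rewrite exp_0, cos_0, sin_0.
  apply injective_projections; simpl; ring.
(* At 0 the argument is a junk value, annihilated by the factor [sqrt 0]. *)
- rewrite Cmod_0, sqrt_0; ring.
Qed.

Lemma Csqrt_RtoC_nonpos (x : R) : x <= 0 -> Csqrt (RtoC x) = (0, sqrt (- x)).
Proof.
intros hx.
destruct (Rle_lt_or_eq_dec x 0 hx) as [h | ->].
- unfold Csqrt; rewrite Carg_RtoC_neg, Cmod_R, Rabs_left by assumption.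
  unfold Cexp; simpl.
  replace (0 * (PI / 2) - 1 * 0) with 0 by ring.
  replace (0 * 0 + 1 * (PI / 2)) with (PI / 2) by field.
  rewrite exp_0, cos_PI2, sin_PI2.
  apply injective_projections; simpl; ring.
- rewrite Csqrt_RtoC_nonneg, Ropp_0, sqrt_0 by lra; reflexivity.
Qed.

Lemma RtoC_sqr_sub_1 (x : R) : (RtoC x ^ 2 - RtoC 1)%C = RtoC (x ^ 2 - 1).
Proof. now rewrite RtoC_minus, RtoC_pow. Qed.

(** The point [x + i sqrt (1 - x^2)] lies on the upper unit semicircle, so its logarithm is [i]
    times its angle. *)
Lemma Carccosh_le_1 (x : R) : 0 <= x <= 1 -> Carccosh (RtoC x) = (0, acos x).
Proof.
intros hx; unfold Carccosh.
rewrite RtoC_sqr_sub_1, Csqrt_RtoC_nonpos by nra.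
set (y := sqrt _).
assert (hy : 0 <= y) by apply sqrt_pos.
assert (hxy : y * y = 1 - x ^ 2) by (unfold y; rewrite sqrt_sqrt; nra).
assert (hmod : Cmod (RtoC x + (0, y))%C = 1).
{ unfold Cmod; simpl.
  replace ((x + 0) * ((x + 0) * 1) + (0 + y) * ((0 + y) * 1))
    with 1 by nra.
  exact sqrt_1. }
unfold Cln; rewrite hmod, ln_1.
unfold Carg; rewrite hmod; simpl.
destruct (Rlt_dec (0 + y) 0) as [h | _]; [lra |].
f_equal; f_equal; field.
Qed.

Lemma Carccosh_ge_1 (x : R) :
  1 <= x -> Carccosh (RtoC x) = RtoC (ln (x + sqrt (x ^ 2 - 1))).
Proof.
intros hx; unfold Carccosh.
rewrite RtoC_sqr_sub_1, Csqrt_RtoC_nonneg by nra.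
rewrite <- RtoC_plus.
assert (h := sqrt_pos (x ^ 2 - 1)).
unfold Cln; rewrite Carg_RtoC_pos, Cmod_R, Rabs_pos_eq by lra.
reflexivity.
Qed.

Lemma Cexp_neg_sqr (a b : R) :
  Cexp (- (a, b) ^ 2)%C =
  (exp (b ^ 2 - a ^ 2) * cos (2 * a * b),
   - (exp (b ^ 2 - a ^ 2) * sin (2 * a * b))).
Proof.
unfold Cexp; simpl.
replace (- (a * (a * 1 - b * 0) - b * (a * 0 + b * 1)))
  with (b * (b * 1) - a * (a * 1)) by ring.
replace (- (a * (a * 0 + b * 1) + b * (a * 1 - b * 0)))
  with (- (2 * a * b)) by ring.
rewrite cos_neg, sin_neg; f_equal; ring.
Qed.

Lemma Cexp_neg_sqr_Carccosh_le_1 (x : R) :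
  0 <= x <= 1 -> Cexp (- Carccosh (RtoC x) ^ 2)%C = RtoC (exp (acos x ^ 2)).
Proof.
intros hx; rewrite Carccosh_le_1, Cexp_neg_sqr by assumption.
replace (2 * 0 * acos x) with 0 by ring.
rewrite cos_0, sin_0; unfold RtoC; f_equal; [| ring].
rewrite Rmult_1_r; f_equal; ring.
Qed.

Lemma Cexp_neg_sqr_Carccosh_ge_1 (x : R) :
  1 <= x ->
  Cexp (- Carccosh (RtoC x) ^ 2)%C =
  RtoC (exp (- ln (x + sqrt (x ^ 2 - 1)) ^ 2)).
Proof.
intros hx; rewrite Carccosh_ge_1 by assumption.
unfold RtoC at 1; rewrite Cexp_neg_sqr.
replace (2 * ln (x + sqrt (x ^ 2 - 1)) * 0) with 0 by ring.
rewrite cos_0, sin_0; unfold RtoC; f_equal; [| ring].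
rewrite Rmult_1_r; f_equal; ring.
Qed.

(** * The integral over [0, 1] *)

Lemma is_RInt_RtoC (f : R -> R) (a b l : R) :
  is_RInt f a b l ->
  is_RInt (V := C_R_NormedModule) (fun x => RtoC (f x)) a b (RtoC l).
Proof.
intros hf; apply (is_RInt_fct_extend_pair (fun x => RtoC (f x))); simpl.
- exact hf.
- generalize (is_RInt_const a b 0); unfold scal; simpl; unfold mult; simpl.
  now rewrite Rmult_0_r.
Qed.

(* On all of [0 < x], [acos x = atan (sqrt (1 - x^2) / x)]: the junk values
   [acos x = 0] and [sqrt (1 - x^2) = 0] agree beyond 1. *)
Lemma continuous_acos_nonneg (x : R) : 0 <= x -> continuous acos x.
Proof.
intros hx.
destruct (Rle_lt_or_eq_dec 0 x hx) as [h | <-].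
- apply continuous_ext_loc with (fun y => atan (sqrt (1 - y²) / y)).
  + exists (mkposreal x h); intros y hy.
    apply Rabs_def2 in hy; simpl in hy; unfold minus, plus, opp in hy; simpl in hy.
    symmetry; apply acos_atan; lra.
  + apply continuous_comp.
    * apply (continuous_mult (fun y => sqrt (1 - y²)) Rinv).
      -- apply continuous_sqrt_comp.
         apply (ex_derive_continuous (fun y => 1 - y²)).
         unfold Rsqr; auto_derive; trivial.
      -- apply (ex_derive_continuous Rinv); auto_derive; lra.
    * apply continuity_pt_filterlim, derivable_continuous_pt, derivable_pt_atan.
- apply continuity_pt_filterlim, derivable_continuous_pt, derivable_pt_acos; lra.
Qed.

Lemma is_RInt_exp_sqr_acos :
  is_RInt (fun x => exp (acos x ^ 2)) 0 1
    (RInt (fun s => exp (s ^ 2) * sin s) 0 (PI / 2)).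
Proof.
assert (hPI := PI_RGT_0).
(* Two-sided continuity is required even at the endpoint 1, beyond which [acos] takes its default
   value. *)
assert (hcont : forall x, 0 <= x -> continuous (fun y => exp (acos y ^ 2)) x).
{ intros x hx; apply (continuous_comp acos (fun a => exp (a ^ 2))).
  - now apply continuous_acos_nonneg.
  - apply (ex_derive_continuous (fun a => exp (a ^ 2))); auto_derive; trivial. }
assert (hsubst : is_RInt (fun s => scal (- sin s) (exp (acos (cos s) ^ 2)))
                   0 (PI / 2)
                   (RInt (fun x => exp (acos x ^ 2)) (cos 0) (cos (PI / 2)))).
{ apply (is_RInt_comp (fun x => exp (acos x ^ 2)) cos (fun s => - sin s));
    rewrite Rmin_left, Rmax_right by lra; intros s hs.
  - apply hcont, cos_ge_0; lra.
  - split; [auto_derive; [trivial | ring] |].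
    apply (ex_derive_continuous (fun s => - sin s)); auto_derive; trivial. }
rewrite cos_0, cos_PI2 in hsubst.
(* As [cos] decreases, the substituted integral runs from 1 to 0; negating it absorbs the sign of
   [- sin s]. *)
apply is_RInt_opp, (is_RInt_unique (V := R_CompleteNormedModule)) in hsubst.
rewrite (RInt_ext _ (fun s => exp (s ^ 2) * sin s)) in hsubst.
2:{ rewrite Rmin_left, Rmax_right by lra; intros s hs.
    rewrite acos_cos by lra.
    unfold opp, scal; simpl; unfold mult; simpl; ring. }
rewrite hsubst.
apply is_RInt_swap, (RInt_correct (fun x => exp (acos x ^ 2))).
apply (ex_RInt_continuous (fun x => exp (acos x ^ 2))).
rewrite Rmin_right, Rmax_left by lra; intros x hx; apply hcont; lra.
Qed.

(** * Real Gaussian integrals and the hyperbolic tail *)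

Lemma continuous_exp_neg_sqr (x : R) : continuous (fun v => exp (- v ^ 2)) x.
Proof.
apply (ex_derive_continuous (fun v => exp (- v ^ 2))); auto_derive; trivial.
Qed.

Lemma ex_RInt_exp_neg_sqr (a b : R) : ex_RInt (fun v => exp (- v ^ 2)) a b.
Proof.
apply (ex_RInt_continuous (fun v => exp (- v ^ 2))).
intros; apply continuous_exp_neg_sqr.
Qed.

(** This is [sqrt PI / 2] times the real erf. *)
Definition gauss_int (y : R) : R := RInt (fun v => exp (- v ^ 2)) 0 y.

Lemma is_derive_gauss_int (y : R) : is_derive gauss_int y (exp (- y ^ 2)).
Proof.
apply (is_derive_RInt (fun v => exp (- v ^ 2)) gauss_int 0 y).
- apply filter_forall; intros z; apply (RInt_correct (fun v => exp (- v ^ 2))).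
  apply ex_RInt_exp_neg_sqr.
- apply continuous_exp_neg_sqr.
Qed.

(** Substitution [v = c * t]; [c = -1] gives oddness and [c = 1/2] matches the parametrized segment
    of erf at 1/2. *)
Lemma gauss_int_scale (c y : R) :
  is_RInt (fun t => c * exp (- (c * t) ^ 2)) 0 y (gauss_int (c * y)).
Proof.
apply is_RInt_ext with (fun t => scal c (exp (- (c * t + 0) ^ 2))).
- intros t _; unfold scal; simpl; unfold mult; simpl.
  now rewrite Rplus_0_r.
- apply (is_RInt_comp_lin (fun v => exp (- v ^ 2))).
  replace (c * 0 + 0) with 0 by ring; rewrite Rplus_0_r.
  apply (RInt_correct (fun v => exp (- v ^ 2))), ex_RInt_exp_neg_sqr.
Qed.

Lemma gauss_int_opp (y : R) : gauss_int (- y) = - gauss_int y.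
Proof.
replace (- y) with (-1 * y) by ring.
rewrite <- (is_RInt_unique _ _ _ _ (gauss_int_scale (-1) y)).
apply is_RInt_unique.
apply is_RInt_ext with (fun t => opp (exp (- t ^ 2))).
- intros t _; unfold opp; simpl.
  replace ((-1 * t) * (-1 * t * 1)) with (t * (t * 1)) by ring; ring.
- apply (is_RInt_opp (fun v => exp (- v ^ 2))).
  apply (RInt_correct (fun v => exp (- v ^ 2))), ex_RInt_exp_neg_sqr.
Qed.

(* The integral of [exp (- v^2) sinh v] over [u, infinity). *)
Definition sinh_tail (u : R) : R :=
  exp (1 / 4) / 2 * (gauss_int (u + 1 / 2) - gauss_int (u - 1 / 2)).

(* Completing the square: [- u^2 + u = 1/4 - (u - 1/2)^2] and
   [- u^2 - u = 1/4 - (u + 1/2)^2]. *)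
Lemma is_derive_sinh_tail (u : R) :
  is_derive sinh_tail u (- (exp (- u ^ 2) * sinh u)).
Proof.
assert (hd : forall c, is_derive (fun u => gauss_int (u + c)) u
                         (exp (- (u + c) ^ 2))).
{ intros c; evar_last.
  - apply (is_derive_comp gauss_int (fun u => u + c)).
    + apply is_derive_gauss_int.
    + auto_derive; [trivial | reflexivity].
  - unfold scal; simpl; unfold mult; simpl; ring. }
evar_last.
- apply is_derive_scal.
  apply (is_derive_minus (fun u => gauss_int (u + 1 / 2))
           (fun u => gauss_int (u + - (1 / 2)))); apply hd.
- unfold sinh, minus, plus, opp; simpl.
  replace (- ((u + 1 / 2) * ((u + 1 / 2) * 1)))
    with (- (1 / 4) + (- (u * (u * 1)) + - u)) by field.
  replace (- ((u + - (1 / 2)) * ((u + - (1 / 2)) * 1)))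
    with (- (1 / 4) + (- (u * (u * 1)) + u)) by field.
  rewrite !exp_plus, (exp_Ropp (1 / 4)).
  field; apply Rgt_not_eq, exp_pos.
Qed.

(** By the mean value theorem on an interval of length 1, the difference of [gauss_int] values is
    [exp (- c^2)] with [c >= u - 1/2]. Then [(c - 1/2)^2 >= 0] gives
    [- c^2 <= 1/4 - c <= 3/4 - u]. *)
Lemma sinh_tail_bound (u : R) : 0 <= sinh_tail u <= exp 1 * exp (- u).
Proof.
assert (h4 := exp_pos (1 / 4)).
destruct (MVT_gen gauss_int (u - 1 / 2) (u + 1 / 2) (fun y => exp (- y ^ 2)))
  as [c [hc heq]].
- intros; apply is_derive_gauss_int.
- intros x _; apply continuity_pt_filterlim.
  apply (ex_derive_continuous gauss_int); eexists; apply is_derive_gauss_int.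
- rewrite Rmin_left, Rmax_right in hc by lra.
  unfold sinh_tail; rewrite heq.
  replace (u + 1 / 2 - (u - 1 / 2)) with 1 by field.
  assert (hc0 := exp_pos (- c ^ 2)).
  assert (hcu : exp (- c ^ 2) <= exp (3 / 4) * exp (- u)).
  { rewrite <- exp_plus.
    assert (hsq := pow2_ge_0 (c - 1 / 2)).
    assert (hle : - c ^ 2 <= 3 / 4 + - u) by nra.
    destruct (Rle_lt_or_eq_dec _ _ hle) as [h | ->]; [| lra].
    left; apply exp_increasing, h. }
  assert (h1 : exp 1 = exp (1 / 4) * exp (3 / 4))
    by (rewrite <- exp_plus; f_equal; field).
  rewrite h1.
  assert (hp := Rmult_lt_0_compat _ _ h4 hc0).
  assert (hq := Rmult_le_compat_l _ _ _ (Rlt_le _ _ h4) hcu).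
  split; lra.
Qed.

Lemma sinh_tail_0 : sinh_tail 0 = exp (1 / 4) * gauss_int (1 / 2).
Proof.
unfold sinh_tail.
replace (0 + 1 / 2) with (1 / 2) by ring.
replace (0 - 1 / 2) with (- (1 / 2)) by ring.
rewrite gauss_int_opp; field.
Qed.

(** * Real arccosh and the integral over [1, x] *)

Lemma arccosh_nonneg (x : R) : 1 <= x -> 0 <= ln (x + sqrt (x ^ 2 - 1)).
Proof.
intros hx; assert (h := sqrt_pos (x ^ 2 - 1)).
rewrite <- ln_1; apply ln_le; lra.
Qed.

Lemma cosh_arccosh (x : R) : 1 <= x -> cosh (ln (x + sqrt (x ^ 2 - 1))) = x.
Proof.
intros hx; assert (h := sqrt_pos (x ^ 2 - 1)).
assert (hs : sqrt (x ^ 2 - 1) * sqrt (x ^ 2 - 1) = x ^ 2 - 1)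
  by (apply sqrt_sqrt; nra).
unfold cosh; rewrite exp_Ropp, exp_ln by lra.
set (s := sqrt _) in *.
(* The conjugates [x + s] and [x - s] have product 1. *)
replace (/ (x + s)) with (x - s); [field |].
apply Rmult_eq_reg_r with (x + s); [| lra].
rewrite Rinv_l by lra; nra.
Qed.

Lemma arccosh_cosh (u : R) :
  0 <= u -> ln (cosh u + sqrt (cosh u ^ 2 - 1)) = u.
Proof.
intros hu.
assert (hs : 0 <= sinh u).
{ unfold sinh; assert (exp (- u) <= exp u); [| lra].
  destruct (Rle_lt_or_eq_dec 0 u hu) as [h | <-].
  - left; apply exp_increasing; lra.
  - rewrite Ropp_0; lra. }
replace (cosh u ^ 2 - 1) with (sinh u ^ 2).
- rewrite sqrt_pow2 by assumption.
  replace (cosh u + sinh u) with (exp u) by (unfold cosh, sinh; field).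
  apply ln_exp.
- unfold cosh, sinh; rewrite exp_Ropp.
  field; apply Rgt_not_eq, exp_pos.
Qed.

Lemma cosh_ge_1 (u : R) : 1 <= cosh u.
Proof.
unfold cosh; rewrite exp_Ropp.
assert (h := exp_pos u); assert (hi := Rinv_0_lt_compat _ h).
assert (hsq := Rmult_le_pos _ _ (pow2_ge_0 (exp u - 1)) (Rlt_le _ _ hi)).
replace ((exp u - 1) ^ 2 * / exp u) with (exp u + / exp u - 2) in hsq
  by (field; lra).
lra.
Qed.

(** With [y = cosh v] the integrand becomes [exp (- v^2) sinh v], which has antiderivative
    [- sinh_tail]. *)
Lemma is_RInt_exp_neg_sqr_arccosh (x : R) :
  1 <= x ->
  is_RInt (fun y => exp (- ln (y + sqrt (y ^ 2 - 1)) ^ 2)) 1 x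
    (sinh_tail 0 - sinh_tail (ln (x + sqrt (x ^ 2 - 1)))).
Proof.
intros hx.
set (f := fun y => exp (- ln (y + sqrt (y ^ 2 - 1)) ^ 2)).
set (u := ln (x + sqrt (x ^ 2 - 1))).
assert (hu : 0 <= u) by now apply arccosh_nonneg.
(* The inner square root is not differentiable at 1, so it is handled by continuity; only the outer
   map uses a derivative. *)
assert (hcont : forall y, 1 <= y -> continuous f y).
{ intros y hy.
  apply (continuous_comp (fun y => y + sqrt (y ^ 2 - 1))
           (fun w => exp (- ln w ^ 2))).
  - apply (continuous_plus (V := R_NormedModule) (fun y => y)
             (fun y => sqrt (y ^ 2 - 1))); [apply continuous_id |].
    apply continuous_sqrt_comp.
    apply (ex_derive_continuous (fun y => y ^ 2 - 1)); auto_derive; trivial.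
  - assert (h := sqrt_pos (y ^ 2 - 1)).
    apply (ex_derive_continuous (fun w => exp (- ln w ^ 2))); auto_derive; lra. }
assert (hsubst : is_RInt (fun v => scal (sinh v) (f (cosh v))) 0 u
                   (RInt f (cosh 0) (cosh u))).
{ apply (is_RInt_comp f cosh sinh); intros v _.
  - apply hcont, cosh_ge_1.
  - split; [apply is_derive_Reals, derivable_pt_lim_cosh |].
    apply (ex_derive_continuous sinh); exists (cosh v).
    apply is_derive_Reals, derivable_pt_lim_sinh. }
unfold u at 2 in hsubst; rewrite cosh_0, cosh_arccosh in hsubst by assumption.
assert (hftc : is_RInt (fun v => exp (- v ^ 2) * sinh v) 0 u
                 (sinh_tail 0 - sinh_tail u)).
{ apply is_RInt_ext with (fun v => opp (- (exp (- v ^ 2) * sinh v))).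
  - intros v _; unfold opp; simpl; ring.
  - replace (sinh_tail 0 - sinh_tail u)
      with (opp (minus (sinh_tail u) (sinh_tail 0)))
      by (unfold opp, minus, plus; simpl; unfold opp; simpl; ring).
    apply (is_RInt_opp (fun v => - (exp (- v ^ 2) * sinh v))).
    apply (is_RInt_derive sinh_tail).
    + intros v _; apply is_derive_sinh_tail.
    + intros v _.
      apply (ex_derive_continuous (fun v => - (exp (- v ^ 2) * sinh v))).
      unfold sinh; auto_derive; trivial. }
apply (is_RInt_unique (V := R_CompleteNormedModule)) in hsubst; apply (is_RInt_unique (V := R_CompleteNormedModule)) in hftc.
rewrite <- hftc.
rewrite (RInt_ext _ (fun v => scal (sinh v) (f (cosh v)))).
- rewrite hsubst; apply (RInt_correct f), (ex_RInt_continuous f).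
  rewrite Rmin_left, Rmax_right by assumption.
  intros y hy; apply hcont; lra.
- rewrite Rmin_left, Rmax_right by assumption; intros v hv.
  unfold f; rewrite arccosh_cosh by lra.
  unfold scal; simpl; unfold mult; simpl; ring.
Qed.

(** * The complex erf on the line of real part 1/2 *)

(* [erf_re b t] and [erf_im b t] are the real and imaginary parts of
   [exp (- t^2 z^2) z] at [z = 1/2 + i b]. *)
Definition erf_re (b t : R) : R :=
  exp (t ^ 2 * (b ^ 2 - 1 / 4)) * (1 / 2 * cos (t ^ 2 * b) + b * sin (t ^ 2 * b)).

Definition erf_im (b t : R) : R :=
  exp (t ^ 2 * (b ^ 2 - 1 / 4)) * (b * cos (t ^ 2 * b) - 1 / 2 * sin (t ^ 2 * b)).

(** The partial derivative of [erf_re] in [b], grouped by sine and cosine. *)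
Definition erf_re_db (b t : R) : R :=
  exp (t ^ 2 * (b ^ 2 - 1 / 4)) *
  ((1 + 2 * t ^ 2 * (b ^ 2 - 1 / 4)) * sin (t ^ 2 * b) +
   2 * t ^ 2 * b * cos (t ^ 2 * b)).

Lemma Cerf_half (b : R) :
  Cerf (1 / 2, b)%R =
  (RtoC (2 / sqrt PI) * (RInt (erf_re b) 0 1, RInt (erf_im b) 0 1))%C.
Proof.
unfold Cerf; f_equal.
apply is_RInt_unique.
apply (is_RInt_ext (V := C_R_NormedModule) (fun t => (erf_re b t, erf_im b t))).
- intros t _.
  replace (RtoC t * (1 / 2, b)%R)%C with (t * (1 / 2), t * b)
    by (apply injective_projections; simpl; ring).
  rewrite Cexp_neg_sqr; unfold erf_re, erf_im.
  replace ((t * b) ^ 2 - (t * (1 / 2)) ^ 2)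
    with (t ^ 2 * (b ^ 2 - 1 / 4)) by field.
  replace (2 * (t * (1 / 2)) * (t * b)) with (t ^ 2 * b) by field.
  apply injective_projections; simpl; ring.
- apply (is_RInt_fct_extend_pair (fun t => (erf_re b t, erf_im b t))); simpl.
  + apply (RInt_correct (erf_re b)), (ex_RInt_continuous (erf_re b)).
    intros t _; apply (ex_derive_continuous (erf_re b)).
    unfold erf_re; auto_derive; trivial.
  + apply (RInt_correct (erf_im b)), (ex_RInt_continuous (erf_im b)).
    intros t _; apply (ex_derive_continuous (erf_im b)).
    unfold erf_im; auto_derive; trivial.
Qed.

Lemma erf_re_opp (b t : R) : erf_re (- b) t = erf_re b t.
Proof.
unfold erf_re.
replace (t ^ 2 * - b) with (- (t ^ 2 * b)) by ring.
replace ((- b) ^ 2) with (b ^ 2) by ring.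
rewrite cos_neg, sin_neg; ring.
Qed.

Lemma erf_im_opp (b t : R) : erf_im (- b) t = - erf_im b t.
Proof.
unfold erf_im.
replace (t ^ 2 * - b) with (- (t ^ 2 * b)) by ring.
replace ((- b) ^ 2) with (b ^ 2) by ring.
rewrite cos_neg, sin_neg; ring.
Qed.

(** The real part of the integrand is even in [b] and the imaginary part odd, so only twice the real
    part survives. *)
Lemma Cerf_half_conj_sum (b : R) :
  (Cerf (1 / 2, - b)%R + Cerf (1 / 2, b)%R)%C =
  RtoC (4 / sqrt PI * RInt (erf_re b) 0 1).
Proof.
rewrite !Cerf_half.
rewrite (RInt_ext (erf_re (- b)) (erf_re b)) by (intros; apply erf_re_opp).
rewrite (RInt_ext (erf_im (- b)) (fun t => opp (erf_im b t)))
  by (intros; apply erf_im_opp).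
rewrite (RInt_opp (erf_im b)).
- apply injective_projections; simpl; unfold opp; simpl; field;
    apply Rgt_not_eq, sqrt_lt_R0, PI_RGT_0.
- apply (ex_RInt_continuous (erf_im b)).
  intros t _; apply (ex_derive_continuous (erf_im b)).
  unfold erf_im; auto_derive; trivial.
Qed.

Lemma is_derive_erf_re (b t : R) :
  is_derive (fun c => erf_re c t) b (erf_re_db b t).
Proof. unfold erf_re, erf_re_db; auto_derive; [trivial | unfold Rminus; simpl; field]. Qed.

(** Joint continuity justifies differentiating under the integral sign. *)
Lemma continuity_2d_erf_re_db (b t : R) : continuity_2d_pt erf_re_db b t.
Proof.
assert (hpow : forall (f : R -> R -> R), continuity_2d_pt f b t ->
                 continuity_2d_pt (fun u v => f u v ^ 2) b t).
{ intros f hf; apply continuity_2d_pt_mult; [assumption |].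
  apply continuity_2d_pt_mult; [assumption | apply continuity_2d_pt_const]. }
unfold erf_re_db, Rminus.
repeat first
  [ apply continuity_2d_pt_const
  | apply continuity_2d_pt_id1
  | apply continuity_2d_pt_id2
  | apply hpow
  | apply continuity_2d_pt_plus
  | apply (continuity_1d_2d_pt_comp exp);
    [apply derivable_continuous_pt, derivable_pt_exp |]
  | apply (continuity_1d_2d_pt_comp sin);
    [apply derivable_continuous_pt, derivable_pt_sin |]
  | apply (continuity_1d_2d_pt_comp cos);
    [apply derivable_continuous_pt, derivable_pt_cos |]
  | apply continuity_2d_pt_mult ].
Qed.

(* The Cauchy-Riemann cancellation that makes erf path independent: with
   [z = 1/2 + i b], the [b]-derivative of [exp (- t^2 z^2) z] is the
   [t]-derivative of [i t exp (- t^2 z^2)]. *)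
Lemma RInt_erf_re_db (b : R) :
  RInt (erf_re_db b) 0 1 = exp (b ^ 2 - 1 / 4) * sin b.
Proof.
apply is_RInt_unique.
set (h := fun t => t * (exp (t ^ 2 * (b ^ 2 - 1 / 4)) * sin (t ^ 2 * b))).
replace (exp (b ^ 2 - 1 / 4) * sin b) with (minus (h 1) (h 0)).
- apply (is_RInt_derive h).
  + intros t _; unfold h, erf_re_db; auto_derive; [trivial | unfold Rminus; simpl; field].
  + intros t _; apply (ex_derive_continuous (erf_re_db b)).
    unfold erf_re_db; auto_derive; trivial.
- unfold h, minus, plus, opp; simpl.
  replace (1 * (1 * 1)) with 1 by ring.
  rewrite !Rmult_1_l; ring.
Qed.

Lemma is_derive_RInt_erf_re (b : R) :
  is_derive (fun c => RInt (erf_re c) 0 1) b (exp (b ^ 2 - 1 / 4) * sin b).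
Proof.
assert (hD : forall c t, Derive (fun z => erf_re z t) c = erf_re_db c t)
  by (intros; apply is_derive_unique, is_derive_erf_re).
rewrite <- RInt_erf_re_db.
rewrite (RInt_ext _ (fun t => Derive (fun c => erf_re c t) b))
  by (intros; symmetry; apply hD).
apply (is_derive_RInt_param erf_re).
- apply filter_forall; intros c t _; eexists; apply is_derive_erf_re.
- intros t _; apply continuity_2d_pt_ext with erf_re_db.
  + intros; symmetry; apply hD.
  + apply continuity_2d_erf_re_db.
- apply filter_forall; intros c; apply (ex_RInt_continuous (erf_re c)).
  intros t _; apply (ex_derive_continuous (erf_re c)).
  unfold erf_re; auto_derive; trivial.
Qed.

Lemma RInt_erf_re_0 : RInt (erf_re 0) 0 1 = gauss_int (1 / 2).
Proof.
rewrite <- (Rmult_1_r (1 / 2)).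
rewrite <- (is_RInt_unique _ _ _ _ (gauss_int_scale (1 / 2) 1)).
apply RInt_ext; intros t _; unfold erf_re.
rewrite Rmult_0_r, cos_0, sin_0.
replace (t ^ 2 * (0 ^ 2 - 1 / 4)) with (- (1 / 2 * t) ^ 2) by field.
rewrite Rmult_0_l, Rplus_0_r, Rmult_1_r; apply Rmult_comm.
Qed.

(** Integrates the derivative in [b] from 0; the factor [exp (1 / 4)] cancels the [- 1/4] in its
    exponent. At [b = PI / 2] the right side is the [0, 1] contribution plus [sinh_tail 0]. *)
Lemma RInt_erf_re (b : R) :
  exp (1 / 4) * RInt (erf_re b) 0 1 =
  RInt (fun s => exp (s ^ 2) * sin s) 0 b + exp (1 / 4) * gauss_int (1 / 2).
Proof.
assert (hftc : is_RInt (fun s => exp (s ^ 2 - 1 / 4) * sin s) 0 b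
                 (RInt (erf_re b) 0 1 - RInt (erf_re 0) 0 1)).
{ apply (is_RInt_derive (fun c => RInt (erf_re c) 0 1)).
  - intros c _; apply is_derive_RInt_erf_re.
  - intros c _.
    apply (ex_derive_continuous (fun s => exp (s ^ 2 - 1 / 4) * sin s)).
    auto_derive; trivial. }
apply (is_RInt_scal _ _ _ (exp (1 / 4))) in hftc.
apply (is_RInt_unique (V := R_CompleteNormedModule)) in hftc.
rewrite (RInt_ext _ (fun s => exp (s ^ 2) * sin s)) in hftc.
- rewrite hftc, RInt_erf_re_0.
  unfold scal; simpl; unfold mult; simpl; ring.
- intros s _; unfold scal; simpl; unfold mult; simpl.
  rewrite <- Rmult_assoc, <- exp_plus; f_equal; f_equal; ring.
Qed.

(** * Truncated integrals and their limit *)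

Lemma is_RInt_exp_neg_sqr_Carccosh (x : R) :
  1 <= x ->
  is_RInt (V := C_R_NormedModule)
    (fun y : R => Cexp (- (Carccosh (RtoC y)) ^ 2)%C) 0 x
    (RtoC (exp (1 / 4) * RInt (erf_re (PI / 2)) 0 1 -
           sinh_tail (ln (x + sqrt (x ^ 2 - 1))))).
Proof.
intros hx.
rewrite RInt_erf_re, <- sinh_tail_0.
unfold Rminus; rewrite Rplus_assoc, RtoC_plus.
apply (is_RInt_Chasles (V := C_R_NormedModule) _ 0 1 x).
- apply is_RInt_ext with (fun y => RtoC (exp (acos y ^ 2))).
  + rewrite Rmin_left, Rmax_right by lra; intros y hy.
    symmetry; apply Cexp_neg_sqr_Carccosh_le_1; lra.
  + apply is_RInt_RtoC, is_RInt_exp_sqr_acos.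
- apply is_RInt_ext with
    (fun y => RtoC (exp (- ln (y + sqrt (y ^ 2 - 1)) ^ 2))).
  + rewrite Rmin_left, Rmax_right by lra; intros y hy.
    symmetry; apply Cexp_neg_sqr_Carccosh_ge_1; lra.
  + apply is_RInt_RtoC, is_RInt_exp_neg_sqr_arccosh; assumption.
Qed.

(** Here [exp (- u)] is [1 / (x + sqrt (x^2 - 1))], at most [1 / x]; hence the truncation error
    tends to 0. *)
Lemma sinh_tail_arccosh_bound (x : R) :
  1 <= x -> 0 <= sinh_tail (ln (x + sqrt (x ^ 2 - 1))) <= exp 1 / x.
Proof.
intros hx.
destruct (sinh_tail_bound (ln (x + sqrt (x ^ 2 - 1)))) as [hlo hhi].
split; [assumption |].
apply Rle_trans with (1 := hhi).
assert (h := sqrt_pos (x ^ 2 - 1)).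
rewrite exp_Ropp, exp_ln by lra.
apply Rmult_le_compat_l; [apply Rlt_le, exp_pos |].
apply Rinv_le_contravar; lra.
Qed.

Theorem theorem3p12 :
  is_RInt_gen (V := C_R_NormedModule)
    (fun x : R => Cexp (- (Carccosh (RtoC x)) ^ 2)%C)
    (at_point 0) (Rbar_locally p_infty)
    (RtoC (sqrt PI / 4 * exp (1 / 4)) *
     (Cerf (RtoC (1 / 2) - Ci * RtoC (PI / 2)) +
      Cerf (RtoC (1 / 2) + Ci * RtoC (PI / 2))))%C.
Proof.
replace (RtoC (1 / 2) - Ci * RtoC (PI / 2))%C with (1 / 2, - (PI / 2))
  by (apply injective_projections; simpl; ring).
replace (RtoC (1 / 2) + Ci * RtoC (PI / 2))%C with (1 / 2, PI / 2)
  by (apply injective_projections; simpl; ring).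
rewrite Cerf_half_conj_sum, <- RtoC_mult.
replace (sqrt PI / 4 * exp (1 / 4) *
         (4 / sqrt PI * RInt (erf_re (PI / 2)) 0 1))
  with (exp (1 / 4) * RInt (erf_re (PI / 2)) 0 1)
  by (field; apply Rgt_not_eq, sqrt_lt_R0, PI_RGT_0).
set (l := exp (1 / 4) * RInt (erf_re (PI / 2)) 0 1).
intros P [eps hP].
(* The bound 1 makes the closed form of the truncated integral available; [exp 1 / eps] forces the
   error bound [exp 1 / x] below [eps]. *)
apply Filter_prod with (fun a => a = 0)
  (fun x => Rmax 1 (exp 1 / eps) < x).
- reflexivity.
- exists (Rmax 1 (exp 1 / eps)); trivial.
- intros a x -> hx.
  assert (h1 : 1 < x) by (apply Rle_lt_trans with (2 := hx); apply Rmax_l).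
  assert (heps : exp 1 / eps < x)
    by (apply Rle_lt_trans with (2 := hx); apply Rmax_r).
  assert (he := cond_pos eps).
  exists (RtoC (l - sinh_tail (ln (x + sqrt (x ^ 2 - 1))))); split.
  + apply is_RInt_exp_neg_sqr_Carccosh; lra.
  (* Both imaginary parts are 0, so only the real parts need an estimate. *)
  + apply hP; split; [| apply ball_center].
    destruct (sinh_tail_arccosh_bound x) as [hlo hhi]; [lra |].
    assert (hlt : exp 1 / x < eps).
    { apply Rmult_lt_reg_r with (x / eps); [apply Rdiv_lt_0_compat; lra |].
      replace (exp 1 / x * (x / eps)) with (exp 1 / eps) by (field; lra).
      replace (eps * (x / eps)) with x by (field; lra).
      assumption. }
    change (Rabs (l - sinh_tail (ln (x + sqrt (x ^ 2 - 1))) - l) < eps).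
    apply Rabs_def1; lra.
Qed.
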